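(* Let $A,B,C$ be integers with $A$ odd, squarefree and negative, $\gcd(A,5)=1$, $B,C>0$ and $B^2+C^2=5$ (so $(B,C)\in\{(1,2),(2,1)\}$), and let $K=\mathbb{Q}(\sqrt{A(5+B\sqrt5)})$, a totally imaginary quadratic extension of $\mathbb{Q}(\sqrt5)$ with $K/\mathbb{Q}$ cyclic. Put $\alpha=\sqrt{A(5+B\sqrt5)}$ and define $\zeta\in K$ by: $\zeta=\alpha/(-20A)$ in case (ii); $\zeta=\alpha/(-10A)$ in case (iii); $\zeta=\alpha/(-5A)$ in cases (iv) and (v). Let $\varphi_1,\varphi_2:K\hookrightarrow\mathbb{C}$ be the embeddings with $\mathrm{Im}(\zeta^{\varphi_j})>0$ (one restricting to the identity and one to the nontrivial automorphism of $\mathbb{Q}(\sqrt5)$), $u(x)={}^t(x^{\varphi_1},x^{\varphi_2})$, $\Lambda(\mathfrak{O}_K)=u(\mathfrak{O}_K)$, and $E(z,w)=\sum_{j=1}^2\zeta^{\varphi_j}(z_j\overline{w_j}-\overline{z_j}w_j)$ (so $E(u(x),u(y))=\mathrm{Tr}_{K/\mathbb{Q}}(\zeta xy^\rho)$). Then $E$ gives a principal polarization on the abelian surface $A(\mathfrak{O}_K)=\mathbb{C}^2/\Lambda(\mathfrak{O}_K)$.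
   Context: $\rho$ is complex conjugation. The cases are: (ii) $B$ odd; (iii) $B$ even and $A+B\equiv3\pmod 4$; (iv) $B$ even, $A+B\equiv1\pmod4$, $A\equiv C\pmod4$; (v) $B$ even, $A+B\equiv1\pmod4$, $A\equiv-C\pmod4$. A Riemann form $E$ gives a principal polarization if it is $\mathbb{Z}$-valued on $\Lambda\times\Lambda$ with Pfaffian $1$ (unimodular) and $E(z,\sqrt{-1}w)$ is symmetric positive definite. *)

(* Defs.v *)
From HB Require Import structures.
From mathcomp Require Import all_boot all_order all_algebra all_field.
From mathcomp Require Import complex.
From mathcomp Require Import classical_sets reals.

Set Implicit Arguments.
Unset Strict Implicit.
Unset Printing Implicit Defensive.

Import Order.TTheory GRing.Theory Num.Theory.

Local Open Scope ring_scope.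
Local Open Scope complex_scope.
Local Open Scope classical_set_scope.

Definition squarefree (a : int) : Prop :=
  forall d : int, (d ^+ 2 %| a)%Z -> d \is a GRing.unit.

Definition case_ii (B : int) : bool := ~~ (2 %| B)%Z.

Definition case_iii (A B : int) : bool :=
  (2 %| B)%Z && (A + B == 3 %[mod 4])%Z.

Definition case_iv (A B C : int) : bool :=
  [&& (2 %| B)%Z, (A + B == 1 %[mod 4])%Z & (A == C %[mod 4])%Z].

Definition case_v (A B C : int) : bool :=
  [&& (2 %| B)%Z, (A + B == 1 %[mod 4])%Z & (A == - C %[mod 4])%Z].

(* The final default value is never reached when A is odd and B^2 + C^2 = 5. *)
Definition zeta (K : fieldType) (A B C : int) (alpha : K) : K :=
  if case_ii B then alpha / (- 20 * A)%:~R
  else if case_iii A B then alpha / (- 10 * A)%:~R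
  else if case_iv A B C || case_v A B C then alpha / (- 5 * A)%:~R
  else 0.

Definition ring_of_integers (K : fieldExtType rat) : set K :=
  [set x | integralOver (intr : int -> K) x].

Section ComplexTori.
Variable R : realType.
Implicit Types (L : set 'cV[R[i]]_2) (b : 'I_4 -> 'cV[R[i]]_2).
Implicit Types E : 'cV[R[i]]_2 -> 'cV[R[i]]_2 -> R[i].

(* Four R-independent vectors form an R-basis of C^2, so a subgroup L
   admitting such a b is a lattice of full rank, i.e. C^2/L is a complex
   torus. *)
Definition lattice_basis L b : Prop :=
  (forall r : 'I_4 -> R, \sum_i (r i)%:C *: b i = 0 -> forall i, r i = 0) /\
  L = [set z | exists n : 'I_4 -> int, z = \sum_i b i *~ n i].

Definition pfaffian4 (F : comPzRingType) (M : 'M[F]_4) : F :=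
  let m (i j : nat) := M (inord i) (inord j) in
  m 0%N 1%N * m 2%N 3%N - m 0%N 2%N * m 1%N 3%N + m 0%N 3%N * m 1%N 2%N.

Record riemann_form L E : Prop := RiemannForm {
  riemann_real : forall z w, E z w \is Num.real;
  riemann_linearl : forall (r : R) z1 z2 w,
    E (r%:C *: z1 + z2) w = r%:C * E z1 w + E z2 w;
  riemann_linearr : forall (r : R) z w1 w2,
    E z (r%:C *: w1 + w2) = r%:C * E z w1 + E z w2;
  riemann_alternating : forall z, E z z = 0;
  riemann_integral : forall z w, L z -> L w -> exists n : int, E z w = n%:~R;
  riemann_symmetric : forall z w, E z ('i%C *: w) = E w ('i%C *: z);
  riemann_positive : forall z, z != 0 -> 0 < E z ('i%C *: z)
}.

(* The Pfaffian of E on L is that of its Gram matrix in a Z-basis of L; a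
   change of Z-basis multiplies it by the determinant, 1 or -1, so Pfaffian 1
   means that it is 1 for a suitably ordered Z-basis. *)
Definition principal_polarization L E : Prop :=
  riemann_form L E /\
  exists2 b, lattice_basis L b & pfaffian4 (\matrix_(i, j) E (b i) (b j)) = 1.

Variables (K : fieldExtType rat) (phi : 'I_2 -> {rmorphism K -> R[i]}).

Definition umap (x : K) : 'cV[R[i]]_2 := \col_j phi j x.

Definition Lambda (I : set K) : set 'cV[R[i]]_2 := umap @` I.

Definition Eform (z0 : K) (z w : 'cV[R[i]]_2) : R[i] :=
  \sum_j phi j z0 * (z j 0 * (w j 0)^*%C - (z j 0)^*%C * w j 0).

End ComplexTori.

(* Main.v *)
Require Import Defs.
From HB Require Import structures.
From mathcomp Require Import all_boot all_order all_algebra all_field.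
From mathcomp Require Import complex.
From mathcomp Require Import classical_sets reals.
From mathcomp Require Import ring lra zify.

Set Implicit Arguments.
Unset Strict Implicit.
Unset Printing Implicit Defensive.

Import Order.TTheory GRing.Theory Num.Theory.

Local Open Scope ring_scope.
Local Open Scope complex_scope.

(* Let w = (1 + sqrt 5) / 2, so that Z[w] is the ring of integers of
   k = Q(sqrt 5).  Since B^2 + C^2 = 5, only cases (ii), (iii), (v) occur, and
   alpha^2 = 2 A (2 + w) if B = 1, alpha^2 = A (3 + 4 w) if B = 2, where 2 + w
   and 3 + 4 w have norm 5.

   The ring of integers of K is Z[w] + Z[w] theta with theta = alpha in cases
   (ii) and (iii), and theta = (1 + alpha) / 2 in case (v).  Indeed, if
   x = b + c alpha is integral over Z with b, c in k, then 2 b, 2 c alpha^2 and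
   b^2 - c^2 alpha^2 lie in Z[w]; the square of 2 c alpha^2 is a multiple of
   alpha^2, and as 2 A is squarefree and prime to 5, so is 2 c alpha^2 itself.
   Hence 2 b and 2 c lie in Z[w], and a computation modulo 4 concludes.

   For a, b, c, d in Z[w] one finds E(a + b theta, c + d theta) =
   Tr_{k/Q}((a d - b c) eps / sqrt 5), with eps = w in case (ii) and
   eps = w^3 = 2 + sqrt 5 otherwise.  As Tr(w^n / sqrt 5) is the Fibonacci
   number F_n, the Pfaffian in the basis w, 1, theta, w theta is
   F_e F_{e+2} - F_{e+1}^2 = 1 for e = 1, 3. *)

(** * The form on Z[w] + Z[w] theta *)

Section IntegralCombinations.
Variable K : fieldType.
Implicit Types (s w theta : K).

Definition golden s : K := (1 + s) / 2.

Definition int_comb w theta (m n k l : int) : K :=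
  m%:~R + n%:~R * w + (k%:~R + l%:~R * w) * theta.

End IntegralCombinations.

Section PolarizationFromBasis.
Variables (R : realType) (K : fieldExtType rat).
Variables (phi : 'I_2 -> {rmorphism K -> R[i]}).
Variables (sqrt5 theta xi : K) (r5 h : R) (t y : 'I_2 -> R) (f1 f2 : int).

Let sg (j : 'I_2) : R := if j == 0 then r5 else - r5.
Let w : K := golden sqrt5.

Hypothesis r5_sq : r5 ^+ 2 = 5.
Hypothesis phi_sqrt5 : forall j, phi j sqrt5 = (sg j)%:C.
Hypothesis phi_theta : forall j, phi j theta = h +i* t j.
Hypothesis phi_xi : forall j, phi j xi = 0 +i* y j.
Hypothesis t_neq0 : forall j, t j != 0.
Hypothesis y_gt0 : forall j, 0 < y j.
(* [f1] and [f2] are the traces of [eps / sqrt 5] and [w eps / sqrt 5]. *)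
Hypothesis trace_dual : forall j,
  2 * y j * t j = f1%:~R / 2 + (2 * f2%:~R - f1%:~R) / 10 * sg j.
Hypothesis f_unimod : f1 * (f1 + f2) - f2 ^+ 2 = 1.

Let lin := int_comb w theta.

(** Putting [w] before [1] makes the Pfaffian 1; the opposite order would give -1. *)
Let bas (i : 'I_4) : K := nth 0 [:: w; 1; theta; w * theta] i.

(** Both [phi j xi] and z conj(v) - conj(z) v = 2i Im(z conj(v)) are purely imaginary, so each
    summand is real. *)
Lemma EformE z v : Eform phi xi z v =
  (\sum_j 2 * y j * (complex.Re (z j 0) * complex.Im (v j 0)
     - complex.Im (z j 0) * complex.Re (v j 0)))%:C.
Proof.
rewrite rmorph_sum; apply: eq_bigr => j _; rewrite phi_xi.
case: (z j 0) => a b; case: (v j 0) => c d /=.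
by apply/eqP; rewrite eq_complex /=; apply/andP; split; apply/eqP; ring.
Qed.

Let phi_w j : phi j w = ((1 + sg j) / 2)%:C.
Proof.
by rewrite /w /golden fmorph_div rmorphD rmorph1 phi_sqrt5 rmorph_nat fmorph_div
  rmorphD rmorph1 rmorph_nat.
Qed.

Let phi_lin j m n k l : phi j (lin m n k l) =
  (m%:~R + n%:~R * ((1 + sg j) / 2)
     + (k%:~R + l%:~R * ((1 + sg j) / 2)) * h)
  +i* ((k%:~R + l%:~R * ((1 + sg j) / 2)) * t j).
Proof.
rewrite /lin; move: w (phi_w j) => v phi_v; rewrite /int_comb.
rewrite !(rmorphD, rmorphM) /= !rmorph_int phi_v phi_theta.
rewrite -!(rmorph_int (real_complex R)) /= -!rmorphM -!rmorphD.
by apply/eqP; rewrite eq_complex /=; apply/andP; split; apply/eqP; ring.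
Qed.

(** In E(a + b theta, c + d theta) the common real part [h] cancels, leaving [2 * y j * t j] times
    the j-th conjugate of ad - bc. By [trace_dual], summing over both conjugates sends p + q w to p
    f1 + q f2. *)
Lemma Eform_lin m n k l m' n' k' l' :
  Eform phi xi (umap phi (lin m n k l)) (umap phi (lin m' n' k' l')) =
  ((m * k' + n * l' - k * m' - l * n') * f1
   + (m * l' + n * k' + n * l' - k * n' - l * m' - l * n') * f2)%:~R.
Proof.
rewrite EformE -(rmorph_int (real_complex R)); congr (_%:C).
rewrite big_ord_recl big_ord1 !mxE !phi_lin /=.
have e0 := trace_dual 0; have e1 := trace_dual 1.
rewrite /sg /= in e0 e1 *.
rewrite !(rmorphD, rmorphB, rmorphM) /=.
have -> : lift ord0 0 = 1 :> 'I_2 by apply/val_inj.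
rewrite /=.
set S := (X in X = _).
pose d0 (q : R) := m%:~R + n%:~R * ((1 + q) / 2).
pose d1 (q : R) := k%:~R + l%:~R * ((1 + q) / 2).
pose d0' (q : R) := m'%:~R + n'%:~R * ((1 + q) / 2).
pose d1' (q : R) := k'%:~R + l'%:~R * ((1 + q) / 2).
have -> : S = (2 * y 0 * t 0) * (d0 r5 * d1' r5 - d1 r5 * d0' r5)
   + (2 * y 1 * t 1) * (d0 (- r5) * d1' (- r5) - d1 (- r5) * d0' (- r5)).
  by rewrite /S /d0 /d1 /d0' /d1'; ring.
rewrite e0 e1 /d0 /d1 /d0' /d1'; move: r5_sq; rewrite expr2 => r5_sq'.
by field: r5_sq'.
Qed.

Lemma polarization_of_basis (O : set K) :
  O = [set x | exists m n k l, x = lin m n k l]%classic ->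
  principal_polarization (Lambda phi O) (Eform phi xi).
Proof.
move=> ->; split; first split.
- by move=> z v; rewrite EformE; apply/complex_realP; eexists.
- move=> r z1 z2 v; rewrite !EformE -rmorphM -rmorphD; congr (_%:C).
  rewrite mulr_sumr -big_split; apply: eq_bigr => j _; rewrite !mxE.
  case: (z1 j 0) (z2 j 0) (v j 0) => [a b] [c d] [e f] /=; ring.
- move=> r v z1 z2; rewrite !EformE -rmorphM -rmorphD; congr (_%:C).
  rewrite mulr_sumr -big_split; apply: eq_bigr => j _; rewrite !mxE.
  case: (z1 j 0) (z2 j 0) (v j 0) => [a b] [c d] [e f] /=; ring.
- move=> z; rewrite EformE big1 ?rmorph0 // => j _; ring.
- move=> _ _ [_ [m [n [k [l ->]]]] <-] [_ [m' [n' [k' [l' ->]]]] <-].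
  by rewrite Eform_lin; eexists.
- move=> z v; rewrite !EformE; congr (_%:C); apply: eq_bigr => j _.
  rewrite !mxE; case: (z j 0) (v j 0) => [a b] [c d] /=; ring.
- move=> z z_neq0; rewrite EformE ltcR.
  have term j : 2 * y j * (complex.Re (z j 0) * complex.Im (('i%C *: z) j 0)
     - complex.Im (z j 0) * complex.Re (('i%C *: z) j 0)) =
     2 * y j * (complex.Re (z j 0) ^+ 2 + complex.Im (z j 0) ^+ 2).
    by rewrite !mxE; case: (z j 0) => a b /=; ring.
  under eq_bigr do rewrite term.
  have ge0 j :
      0 <= 2 * y j * (complex.Re (z j 0) ^+ 2 + complex.Im (z j 0) ^+ 2).
    by rewrite mulr_ge0 ?addr_ge0 ?sqr_ge0 // mulr_ge0 // ltW.
  rewrite lt_neqAle sumr_ge0 // andbT eq_sym; apply: contraNneq z_neq0 => s0.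
  apply/eqP/colP => j; rewrite mxE.
  move/psumr_eq0P: s0 => /(_ (fun i _ => ge0 i) j isT) /eqP.
  rewrite !mulf_eq0 pnatr_eq0 /= gt_eqF //= paddr_eq0 ?sqr_ge0 // !sqrf_eq0.
  by case: (z j 0) => a b /= /andP[/eqP-> /eqP->].
(* [lin] takes the coefficient of [1] first while [bas] starts with [w], hence the swapped
   indices. *)
have bas_lin (i : 'I_4) :
    bas i = lin (i == 1 :> nat) (i == 0 :> nat) (i == 2 :> nat) (i == 3 :> nat).
  by case: i => -[|[|[|[|//]]]] ? ; rewrite /bas /lin /int_comb /=; ring.
have sum4 (V : zmodType) (F : 'I_4 -> V) : \sum_i F i = F 0 + F 1 + F 2 + F 3.
  rewrite !big_ord_recl big_ord0 addr0 !addrA.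
  by do !congr (_ + _); congr F; apply/val_inj.
have sum_bas (n : 'I_4 -> int) :
    \sum_i umap phi (bas i) *~ n i = umap phi (lin (n 1) (n 0) (n 2) (n 3)).
  have umapz x k : umap phi x *~ k = umap phi (k%:~R * x).
    by rewrite -scaler_int; apply/colP => j; rewrite !mxE rmorphM rmorph_int.
  have umapD x x' : umap phi x + umap phi x' = umap phi (x + x').
    by apply/colP => j; rewrite !mxE rmorphD.
  rewrite sum4 !umapz !umapD; congr umap.
  by rewrite /bas /lin /int_comb /=; ring.
exists (fun i => umap phi (bas i)).
  split.
    move=> r r0.
    (* Imaginary parts isolate the coefficients of [theta], since [t j] is nonzero; real parts then
       give the other two. Each pair is determined by its values at the distinct roots [r5] and
       [- r5]. *)
    have eqj j : r 1 + r 0 * ((1 + sg j) / 2)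
          + (r 2 + r 3 * ((1 + sg j) / 2)) * h = 0 /\
        (r 2 + r 3 * ((1 + sg j) / 2)) * t j = 0.
      move/colP: r0 => /(_ j); rewrite sum4 !mxE !bas_lin !phi_lin /=.
      move/eqP; rewrite eq_complex /= => /andP[/eqP e1 /eqP e2].
      split; [rewrite -[RHS]e1 | rewrite -[RHS]e2]; ring.
    have r5_neq0 : r5 != 0.
      by rewrite -sqrf_eq0 r5_sq pnatr_eq0.
    have [e0 /eqP] := eqj 0; have [e1 /eqP] := eqj 1.
    rewrite !mulf_eq0 !(negPf (t_neq0 _)) !orbF /sg /= in e0 e1 *.
    move=> /eqP u1 /eqP u0; rewrite u0 u1 !mul0r !addr0 in e0 e1.
    have solve (a b : R) : a + b * ((1 + r5) / 2) = 0 ->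
        a + b * ((1 - r5) / 2) = 0 -> a = 0 /\ b = 0.
      move=> v0 v1; have b0 : b = 0.
        apply: (mulIf r5_neq0); rewrite mul0r.
        by rewrite -[RHS](subrr 0) -{1}v0 -v1; field.
      by move: v0; rewrite b0 mul0r addr0.
    have [r2 r3] := solve _ _ u0 u1; have [r1 r0'] := solve _ _ e0 e1.
    case=> -[|[|[|[|//]]]] lti;
      [rewrite -r0' | rewrite -r1 | rewrite -r2 | rewrite -r3];
      by congr r; apply/val_inj.
  apply/seteqP; split=> [_ [_ [m [n [k [l ->]]]] <-] | _ [n ->]].
    by exists (fun i : 'I_4 => nth 0 [:: n; m; k; l] i); rewrite sum_bas.
  rewrite sum_bas; exists (lin (n 1) (n 0) (n 2) (n 3)) => //=.
  by exists (n 1), (n 0), (n 2), (n 3).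
(* Z[w] and Z[w] theta are isotropic, so the first product vanishes and f1 (f1 + f2) - f2^2
   remains. *)
rewrite /pfaffian4 !mxE !bas_lin !Eform_lin !inordK //=.
rewrite -!rmorphM -!rmorphB -!rmorphD /=.
rewrite -[RHS](rmorph1 (intr : int -> R[i])); congr (_%:~R).
by rewrite -f_unimod; ring.
Qed.

End PolarizationFromBasis.

(** * Divisibility in Z[w] *)

(** With g = gcd(a, t), a = a' g and t = t' g, coprimality of a' and t' gives a' | g. Hence a'^2 |
    a, so a' is a unit. *)
Lemma squarefree_dvdz_sqr (a t : int) :
  squarefree a -> (a %| t ^+ 2)%Z -> (a %| t)%Z.
Proof.
move=> sqf_a; have [-> | t_neq0] := eqVneq t 0; first by rewrite dvdz0.
have [-> | a_neq0] := eqVneq a 0; first by rewrite !dvd0z sqrf_eq0.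
set g := gcdz a t; have g_neq0 : g != 0 by rewrite gcdz_eq0 negb_and a_neq0.
have /dvdzP[a' ea] : (g %| a)%Z := dvdz_gcdl a t.
have /dvdzP[t' et] : (g %| t)%Z := dvdz_gcdr a t.
have cop : coprimez a' t'.
  rewrite /coprimez; apply/eqP/(mulIf g_neq0); rewrite mul1r.
  by rewrite -[in LHS](ger0_norm (_ : 0 <= g)) // mulz_gcdl -ea -et.
rewrite {1}ea {1}et.
have -> : (t' * g) ^+ 2 = t' ^+ 2 * g * g by ring.
rewrite dvdz_mul2r // Gauss_dvdzr; last by rewrite coprimezXr.
move=> /dvdzP[c eg].
have a'_unit : a' \is a GRing.unit.
  by apply: sqf_a; rewrite ea eg; apply/dvdzP; exists c; ring.
rewrite ea et dvdz_mul2r //; apply/dvdzP; exists (t' / a').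
by rewrite divrK.
Qed.

(* For [w = (1 + sqrt 5) / 2], the coordinates of [(m + n w) ^+ 2] are
   [m ^+ 2 + n ^+ 2] and [2 m n + n ^+ 2]. *)
Lemma squarefree_dvd_golden (a m n : int) :
  squarefree a -> gcdz a 5 = 1 ->
  (a %| m ^+ 2 + n ^+ 2)%Z -> (a %| 2 * m * n + n ^+ 2)%Z ->
  (a %| m)%Z /\ (a %| n)%Z.
Proof.
move=> sqf_a a_cop5 d1 d2.
have dv4 t : (a %| 5 * t ^+ 4)%Z -> (a %| t)%Z.
  rewrite Gauss_dvdzr; last by rewrite /coprimez a_cop5.
  by rewrite (exprM t 2 2) => dt;
    do 2 apply: (squarefree_dvdz_sqr sqf_a).
have dn : (a %| n)%Z.
  apply: dv4.
  (* Eliminating [m] between the two coordinates leaves 5 n^4, where 5 is the discriminant of Z[w];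
     this is where [a] must be prime to 5. *)
  have -> : 5 * n ^+ 4 = 4 * n ^+ 2 * (m ^+ 2 + n ^+ 2)
     + (n ^+ 2 - 2 * m * n) * (2 * m * n + n ^+ 2) by ring.
  by rewrite rpredD // dvdz_mull.
split=> //; apply: (squarefree_dvdz_sqr sqf_a).
have -> : m ^+ 2 = (m ^+ 2 + n ^+ 2) - n * n by ring.
by rewrite rpredB // dvdz_mull.
Qed.

(** An even d would give 4 | 2a against a odd; an odd d has d^2 prime to 2, so d^2 | a. *)
Lemma squarefree_double (a : int) :
  squarefree a -> ~~ (2 %| a)%Z -> squarefree (2 * a).
Proof.
move=> sqf_a a_odd d d2.
have [/dvdzP[k ek] | d_odd] := boolP (2 %| d)%Z.
  case/negP: a_odd; apply/dvdzP; case/dvdzP: d2 => c ec.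
  exists (c * k ^+ 2); apply: (@mulfI _ 2) => //.
  by rewrite ec ek; ring.
apply: sqf_a; rewrite -(Gauss_dvdzr a (_ : coprimez _ 2)) //.
rewrite coprimezXl // coprimez_sym /coprimez /gcdz.
by move: d_odd; rewrite dvdzE /= -prime_coprime // /coprime => /eqP ->.
Qed.

Lemma dvd5_sqr (t : int) : (5 %| t ^+ 2)%Z -> (5 %| t)%Z.
Proof. by rewrite !dvdzE abszX Euclid_dvdX // => /andP[]. Qed.

(* [m + n w] is divisible by [a (e0 + e1 w)] in [Z[w]] as soon as its square
   is: [a] is squarefree and unramified, and [e0 + e1 w] has prime norm 5. *)
Lemma golden_dvd_of_sqr (a e0 e1 m n v0 v1 : int) :
  squarefree a -> gcdz a 5 = 1 -> e0 ^+ 2 + e0 * e1 - e1 ^+ 2 = 5 ->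
  m ^+ 2 + n ^+ 2 = a * (e0 * v0 + e1 * v1) ->
  2 * m * n + n ^+ 2 = a * (e1 * v0 + (e0 + e1) * v1) ->
  exists c0 c1, m = a * (e0 * c0 + e1 * c1) /\
    n = a * (e1 * c0 + (e0 + e1) * c1).
Proof.
move=> sqf_a a_cop5 Ne E1 E2.
have a_neq0 : a != 0 by apply/eqP => a0; move: a_cop5; rewrite a0 gcd0z.
have [/dvdzP[m' em] /dvdzP[n' en]] : (a %| m)%Z /\ (a %| n)%Z.
  by apply: squarefree_dvd_golden => //; rewrite ?E1 ?E2 dvdz_mulr.
have {}E1 : e0 * v0 + e1 * v1 = a * (m' ^+ 2 + n' ^+ 2).
  by apply: (mulfI a_neq0); rewrite -E1 em en; ring.
have {}E2 : e1 * v0 + (e0 + e1) * v1 = a * (2 * m' * n' + n' ^+ 2).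
  by apply: (mulfI a_neq0); rewrite -E2 em en; ring.
(* Norms are taken in (e0 + e1 w)(v0 + v1 w) = a (m' + n' w)^2, where p + q w has norm p^2 + p q -
   q^2. *)
have Ny : (a * (m' ^+ 2 + m' * n' - n' ^+ 2)) ^+ 2
    = 5 * (v0 ^+ 2 + v0 * v1 - v1 ^+ 2).
  transitivity ((a * (m' ^+ 2 + n' ^+ 2)) ^+ 2
    + (a * (m' ^+ 2 + n' ^+ 2)) * (a * (2 * m' * n' + n' ^+ 2))
    - (a * (2 * m' * n' + n' ^+ 2)) ^+ 2); first by ring.
  by rewrite -E1 -E2 -Ne; ring.
(* Modulo the prime sqrt 5, [w] is 1/2 = 3, and the norm of p + q w is (p + 3 q)^2 modulo 5. *)
have d5 : (5 %| m' + 3 * n')%Z.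
  have cop : coprimez 5 a by rewrite coprimez_sym /coprimez a_cop5.
  have /dvdzP[c ec] : (5 %| m' ^+ 2 + m' * n' - n' ^+ 2)%Z.
    by rewrite -(Gauss_dvdzr _ cop) dvd5_sqr // Ny dvdz_mulr.
  apply: dvd5_sqr; apply/dvdzP; exists (c + m' * n' + 2 * n' ^+ 2).
  have -> : (m' + 3 * n') ^+ 2 = m' ^+ 2 + m' * n' - n' ^+ 2
     + 5 * (m' * n' + 2 * n' ^+ 2) by ring.
  by rewrite ec; ring.
have de : (5 %| e0 + 3 * e1)%Z.
  apply: dvd5_sqr; apply/dvdzP; exists (1 + e0 * e1 + 2 * e1 ^+ 2).
  by rewrite !mulrDl mul1r -{1}Ne; ring.
case/dvdzP: d5 => f ef; case/dvdzP: de => g eg.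
have {}ef : m' = f * 5 - 3 * n' by rewrite -ef; ring.
have {}eg : e0 = g * 5 - 3 * e1 by rewrite -eg; ring.
(* These are the coordinates of (m' + n' w)(e0 + e1 - e1 w) / 5, the quotient of m' + n' w by e0 +
   e1 w. *)
exists (e0 * f + e1 * f - 3 * g * n' + e1 * n'), (g * n' - e1 * f).
have n5 : (5 : int) != 0 by [].
split; apply: (mulfI n5).
  transitivity (a * (m' * (e0 ^+ 2 + e0 * e1 - e1 ^+ 2))).
    by rewrite Ne em; ring.
  by rewrite ef eg; ring.
transitivity (a * (n' * (e0 ^+ 2 + e0 * e1 - e1 ^+ 2))).
  by rewrite Ne en; ring.
by rewrite eg; ring.
Qed.

(** * Congruences modulo 4 satisfied by the relative norm *)

Lemma int_parity (m : int) : exists q, m = 2 * q \/ m = 2 * q + 1.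
Proof. by exists (m %/ 2)%Z; lia. Qed.

(** Put X = m + n w and Y = c0 + c1 w. The hypotheses say X^2 - 2A(2 + w) Y^2 lies in 4 Z[w]. As 2
    is inert in Z[w], it divides X, hence (2 + w) Y^2, hence Y. Parities are enumerated instead. *)
Lemma even_case_ii (A m n c0 c1 k l : int) : ~~ (2 %| A)%Z ->
  m ^+ 2 + n ^+ 2
    - 2 * A * (2 * (c0 ^+ 2 + c1 ^+ 2) + (2 * c0 * c1 + c1 ^+ 2)) = 4 * k ->
  2 * m * n + n ^+ 2
    - 2 * A * ((c0 ^+ 2 + c1 ^+ 2) + 3 * (2 * c0 * c1 + c1 ^+ 2)) = 4 * l ->
  [/\ (2 %| m)%Z, (2 %| n)%Z, (2 %| c0)%Z & (2 %| c1)%Z].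
Proof.
have [A' [->|->]] := int_parity A => A_odd; first by lia.
have [m' [->|->]] := int_parity m; have [n' [->|->]] := int_parity n;
have [c0' [->|->]] := int_parity c0; have [c1' [->|->]] := int_parity c1;
  rewrite !expr2 => E1 E2; (have F : False by lia) || (split; lia); done.
Qed.

(** Here A(3 + 4w) is -1 modulo 4, so 4 | X^2 + Y^2 for X = m + n w and Y = c0 + c1 w. Then 2 | X +
    Y, so 2 | X Y, and the inert prime 2 divides both. *)
Lemma even_case_iii (A m n c0 c1 k l : int) : (A == 1 %[mod 4])%Z ->
  m ^+ 2 + n ^+ 2
    - A * (3 * (c0 ^+ 2 + c1 ^+ 2) + 4 * (2 * c0 * c1 + c1 ^+ 2)) = 4 * k ->
  2 * m * n + n ^+ 2
    - A * (4 * (c0 ^+ 2 + c1 ^+ 2) + 7 * (2 * c0 * c1 + c1 ^+ 2)) = 4 * l ->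
  [/\ (2 %| m)%Z, (2 %| n)%Z, (2 %| c0)%Z & (2 %| c1)%Z].
Proof.
move=> A1; have [A' ->] : exists A', A = 4 * A' + 1.
  by exists (A %/ 4)%Z; lia.
have [m' [->|->]] := int_parity m; have [n' [->|->]] := int_parity n;
have [c0' [->|->]] := int_parity c0; have [c1' [->|->]] := int_parity c1;
  rewrite !expr2 => E1 E2; (have F : False by lia) || (split; lia); done.
Qed.

(** Now A(3 + 4w) is 1 modulo 4, which only yields 2 | (X - Y)^2 and so 2 | X - Y; this is what lets
    (1 + alpha) / 2 be integral. *)
Lemma even_case_v (A m n c0 c1 k l : int) : (A == 3 %[mod 4])%Z ->
  m ^+ 2 + n ^+ 2
    - A * (3 * (c0 ^+ 2 + c1 ^+ 2) + 4 * (2 * c0 * c1 + c1 ^+ 2)) = 4 * k ->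
  2 * m * n + n ^+ 2
    - A * (4 * (c0 ^+ 2 + c1 ^+ 2) + 7 * (2 * c0 * c1 + c1 ^+ 2)) = 4 * l ->
  (2 %| m - c0)%Z /\ (2 %| n - c1)%Z.
Proof.
move=> A3; have [A' ->] : exists A', A = 4 * A' + 3.
  by exists (A %/ 4)%Z; lia.
have [m' [->|->]] := int_parity m; have [n' [->|->]] := int_parity n;
have [c0' [->|->]] := int_parity c0; have [c1' [->|->]] := int_parity c1;
  rewrite !expr2 => E1 E2; (have F : False by lia) || (split; lia); done.
Qed.

(** * Integral elements of K *)

(** Field morphisms are injective and fix integer polynomials, so integrality can be tested in the
    complex numbers. *)
Lemma integralOver_morph (K L : fieldType) (f : {rmorphism K -> L}) (x : K) :
  integralOver (intr : int -> L) (f x) <-> integralOver (intr : int -> K) x.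
Proof.
have eqf (p : {poly int}) : map_poly intr p = map_poly f (map_poly intr p).
  by rewrite -map_poly_comp; apply: eq_map_poly => n /=; rewrite rmorph_int.
by split=> -[p p_mon]; rewrite ?eqf ?fmorph_root => px; exists p;
  rewrite // eqf fmorph_root.
Qed.

Lemma integralOver_quadratic (K : fieldType) (x b c : K) :
  integralOver (intr : int -> K) b -> integralOver (intr : int -> K) c ->
  x ^+ 2 = b * x + c -> integralOver (intr : int -> K) x.
Proof.
move=> int_b int_c ex; pose p : {poly K} := 'X^2 - (b *: 'X + c%:P).
have sz : (size (b *: 'X + c%:P)%R < size ('X^2 : {poly K})%R)%N.
  rewrite size_polyXn ltnS; apply: leq_trans (size_polyD _ _) _.
  rewrite geq_max (leq_trans (size_scale_leq _ _)) ?size_polyX //.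
  by rewrite (leq_trans (size_polyC_leq1 _)).
apply: (@integral_root_monic _ _ intr x p).
- by rewrite monicE lead_coefDl ?size_polyN // lead_coefXn.
- by rewrite /root !hornerE ex subrr.
apply/integral_poly => i; rewrite !coefE.
apply: (@integral_sub _ _ intr); first exact: (@integral_nat _ _ intr).
apply: (@integral_add _ _ intr).
  by apply: (@integral_mul _ _ intr) => //; apply: (@integral_nat _ _ intr).
by case: ifP => // _; apply: (@integral0 _ _ intr).
Qed.

(** The question is moved through the rationals into [algC], where rational algebraic integers are
    known to be integers. *)
Lemma integral_rat_int (L : numFieldType) (q : rat) :
  integralOver (intr : int -> L) (ratr q) -> exists n : int, q = n%:~R.
Proof.
move/(integralOver_morph (ratr : {rmorphism rat -> L})).
move/(integralOver_morph (ratr : {rmorphism rat -> algC})) => -[p p_mon pq].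
have /intrP[n en] : ratr q \is a @Num.int algC.
  apply: Cint_rat_Aint; first exact: Crat_rat.
  apply: root_monic_Aint pq _ _; first exact: monic_map.
  by apply/polyOverP => i; rewrite coef_map /= intr_int.
exists n; apply: (fmorph_inj (ratr : {rmorphism rat -> algC})).
by rewrite /= en ratr_int.
Qed.

Lemma golden_sqr (K : fieldType) (s : K) : 2%:R != 0 :> K ->
  s ^+ 2 = 5 -> golden s ^+ 2 = golden s + 1.
Proof. by rewrite /golden expr2 => two s_sq; field: s_sq. Qed.

Lemma integralOver_golden (K : fieldType) (s : K) : 2%:R != 0 :> K ->
  s ^+ 2 = 5 -> integralOver (intr : int -> K) (golden s).
Proof.
move=> two s_sq; apply: (integralOver_quadratic (b := 1) (c := 1)).
- exact: (@integral1 _ _ intr).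
- exact: (@integral1 _ _ intr).
- by rewrite mul1r golden_sqr.
Qed.

Lemma integralOver_int_comb (K : fieldType) (w theta : K) (m n k l : int) :
  integralOver (intr : int -> K) w -> integralOver (intr : int -> K) theta ->
  integralOver (intr : int -> K) (int_comb w theta m n k l).
Proof.
move=> int_w int_th.
have int_k p q : integralOver (intr : int -> K) (p%:~R + q%:~R * w).
  apply: (@integral_add _ _ intr); first exact: (@integral_id _ _ intr).
  by apply: (@integral_mul _ _ intr) => //; exact: (@integral_id _ _ intr).
by apply: (@integral_add _ _ intr) => //; exact: (@integral_mul _ _ intr).
Qed.

(** * Coordinates of integral elements over k = Q(sqrt 5) *)

Section RingOfIntegers.
Variables (R : realType) (K : fieldExtType rat).
Variables (iota : {rmorphism rat -> K}) (phi : 'I_2 -> {rmorphism K -> R[i]}).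
Variables (sqrt5 w alpha : K) (r5 : R) (t : 'I_2 -> R) (a e0 e1 : int).

Let sg (j : 'I_2) : R := if j == 0 then r5 else - r5.
Let integral (x : K) := integralOver (intr : int -> K) x.

Hypothesis iotaE : iota =1 in_alg K.
Hypothesis w_def : w = golden sqrt5.
Hypothesis sqrt5_sq : sqrt5 ^+ 2 = 5.
Hypothesis r5_sq : r5 ^+ 2 = 5.
Hypothesis phi_sqrt5 : forall j, phi j sqrt5 = (sg j)%:C.
Hypothesis phi_alpha : forall j, phi j alpha = 0 +i* t j.
Hypothesis alpha_neq0 : alpha != 0.
(** The triple (a, e0, e1) will be (2A, 2, 1) for B = 1 and (A, 3, 4) for B = 2. *)
Hypothesis alpha_sq : alpha ^+ 2 = a%:~R * (e0%:~R + e1%:~R * w).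
Hypothesis e_norm : e0 ^+ 2 + e0 * e1 - e1 ^+ 2 = 5.
Hypothesis a_squarefree : squarefree a.
Hypothesis a_coprime5 : gcdz a 5 = 1.
Hypothesis K_gen : <<1; alpha>>%VS = fullv.

Let two_neq0 : 2%:R != 0 :> K.
Proof. by rewrite -(fmorph_eq0 (phi 0)) rmorph_nat pnatr_eq0. Qed.

Let w_sq : w ^+ 2 = w + 1.
Proof. by rewrite w_def golden_sqr. Qed.

Let phi_w j : phi j w = ((1 + sg j) / 2)%:C.
Proof.
by rewrite w_def fmorph_div rmorphD rmorph1 phi_sqrt5 rmorph_nat fmorph_div
  rmorphD rmorph1 rmorph_nat.
Qed.

Let phi_iota j u : phi j (iota u) = ratr u.
Proof. by rewrite iotaE -(fmorph_rat (phi j)) -alg_num_field. Qed.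

Let r5_neq0 : r5 != 0.
Proof. by rewrite -sqrf_eq0 r5_sq pnatr_eq0. Qed.

Lemma golden_coord_inj (m n m' n' : int) :
  m%:~R + n%:~R * w = m'%:~R + n'%:~R * w -> m = m' /\ n = n'.
Proof.
move=> E.
have Ej j : m%:~R + n%:~R * ((1 + sg j) / 2)
    = m'%:~R + n'%:~R * ((1 + sg j) / 2) :> R.
  apply: complexI; move/(congr1 (phi j)): E.
  rewrite !(rmorphD (phi j)) !(rmorphM (phi j)) /= !(rmorph_int (phi j)) phi_w.
  by rewrite !rmorphD !rmorphM /= !rmorph_int.
have /= := Ej 0; have /= := Ej 1; rewrite /sg /= => E1 E0.
have en : n%:~R = n'%:~R :> R.
  apply: (mulIf r5_neq0).
  have -> : n%:~R * r5 = (m%:~R + n%:~R * ((1 + r5) / 2))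
      - (m%:~R + n%:~R * ((1 - r5) / 2)) by field.
  by rewrite E0 E1; field.
have {}en : n = n' by apply: (@intr_inj R).
split=> //; apply: (@intr_inj R); move: E0; rewrite en; exact: addIr.
Qed.

Let in_k (x : K) := exists u v : rat, x = iota u + iota v * w.

Lemma in_kM x y : in_k x -> in_k y -> in_k (x * y).
Proof.
move=> [u [v ->]] [u' [v' ->]]; exists (u * u' + v * v'), (u * v' + v * u' + v * v').
rewrite !(rmorphD (iota)) !(rmorphM (iota)).
by move: w_sq; rewrite expr2 => E; ring: E.
Qed.

Lemma in_kD x y : in_k x -> in_k y -> in_k (x + y).
Proof.
move=> [u [v ->]] [u' [v' ->]]; exists (u + u'), (v + v').
rewrite !(rmorphD (iota)).
by ring.
Qed.

Lemma in_k_int (n : int) : in_k n%:~R.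
Proof. by exists n%:~R, 0; rewrite rmorph0 mul0r addr0 rmorph_int. Qed.

Lemma in_k_golden : in_k w.
Proof. by exists 0, 1; rewrite rmorph0 rmorph1 mul1r add0r. Qed.

Lemma in_k_alg u : in_k (iota u).
Proof. by exists u, 0; rewrite rmorph0 mul0r addr0. Qed.

(** The trace T = 2u + v, the norm N and 5v = (x - x') sqrt 5, with x' the conjugate of x, are
    rational integers. From (5v)^2 = 5 (T^2 - 4N) the number v is an integer n; then T^2 - 4N = 5
    n^2 forces T and n to have the same parity. *)
Lemma k_integralP x : in_k x -> integral x ->
  exists m n : int, x = m%:~R + n%:~R * w.
Proof.
move=> [u [v ex]] int_x.
have phi_x j : phi j x = (ratr u + ratr v * ((1 + sg j) / 2))%:C.
  rewrite ex rmorphD rmorphM phi_w !phi_iota.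
  by rewrite -!(fmorph_rat (real_complex R)) -rmorphM -rmorphD.
have int_phi j : integralOver (intr : int -> R[i]) (phi j x).
  exact/integralOver_morph.
have [T eT] : exists T : int, 2 * u + v = T%:~R.
  apply: (@integral_rat_int R[i]).
  have -> : ratr (2 * u + v) = phi 0 x + phi 1 x.
    rewrite !phi_x -rmorphD -(fmorph_rat (real_complex R)); congr (_%:C).
    by rewrite /sg /= rmorphD rmorphM /= rmorph_nat; field.
  exact: (@integral_add _ _ intr).
have [N eN] : exists N : int, u ^+ 2 + u * v - v ^+ 2 = N%:~R.
  apply: (@integral_rat_int R[i]).
  have -> : ratr (u ^+ 2 + u * v - v ^+ 2) = phi 0 x * phi 1 x.
    rewrite !phi_x -rmorphM -(fmorph_rat (real_complex R)); congr (_%:C).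
    rewrite /sg /= !(rmorphD, rmorphB, rmorphM, rmorphXn) /=.
    by move: r5_sq; rewrite expr2 => E; field: E.
  exact: (@integral_mul _ _ intr).
have [l el] : exists l : int, 5 * v = l%:~R.
  apply: (@integral_rat_int R[i]).
  have -> : ratr (5 * v) = (phi 0 x - phi 1 x) * phi 0 sqrt5.
    rewrite !phi_x phi_sqrt5 -rmorphB -rmorphM -(fmorph_rat (real_complex R)).
    congr (_%:C); rewrite /sg /= rmorphM /= rmorph_nat.
    by move: r5_sq; rewrite expr2 => E; field: E.
  apply: (@integral_mul _ _ intr); first exact: (@integral_sub _ _ intr).
  apply/integralOver_morph.
  apply: (integralOver_quadratic (b := 0) (c := 5)).
  - exact: (@integral0 _ _ intr).
  - exact: (@integral_nat _ _ intr).
  - by rewrite mul0r add0r.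
have el2 : l ^+ 2 = 5 * (T ^+ 2 - 4 * N).
  apply: (@intr_inj rat); rewrite !(rmorphXn, rmorphM, rmorphB) /=.
  by rewrite -eT -el -eN; ring.
have /dvdzP[n en] : (5 %| l)%Z by apply: dvd5_sqr; rewrite el2 dvdz_mulr.
have ev : v = n%:~R.
  by apply: (@mulfI _ 5) => //; rewrite el en rmorphM /= mulrC.
have eTn : T ^+ 2 - 4 * N = 5 * n ^+ 2.
  by apply: (@mulfI _ 5) => //; rewrite -el2 en; ring.
have [q eq] : exists q, T = 2 * q + n.
  have [T' [?|?]] := int_parity T; have [n' [?|?]] := int_parity n.
  - by exists (T' - n'); lia.
  - by exfalso; subst; move: eTn; rewrite !expr2; lia.
  - by exfalso; subst; move: eTn; rewrite !expr2; lia.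
  - by exists (T' - n'); lia.
exists q, n; rewrite ex ev rmorph_int; congr (_ + _).
suff -> : u = q%:~R by rewrite rmorph_int.
apply: (@mulfI _ 2) => //; apply: (@addIr _ v).
by rewrite eT eq rmorphD rmorphM /= ev.
Qed.

(** Horner induction on a polynomial in [alpha]: multiplication by [alpha] turns (b, c) into (c
    alpha^2, b). *)
Lemma K_coord x : exists b c, [/\ in_k b, in_k c & x = b + c * alpha].
Proof.
have /Fadjoin1_polyP[p ->] : x \in <<1; alpha>>%VS by rewrite K_gen memvf.
elim/poly_ind: p => [|p u [b [c [kb kc IH]]]].
  exists 0, 0; rewrite rmorph0 horner0 mul0r addr0; split=> //; exact: (in_k_int 0).
exists (c * (a%:~R * (e0%:~R + e1%:~R * w)) + iota u), b; split=> //.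
  apply: in_kD; last exact: in_k_alg.
  apply: in_kM => //; apply: in_kM; first exact: in_k_int.
  apply: in_kD; first exact: in_k_int.
  by apply: in_kM; [exact: in_k_int | exact: in_k_golden].
rewrite -alpha_sq rmorphD rmorphM /= map_polyX map_polyC hornerMXaddC IH iotaE.
by ring.
Qed.

Let integral_int n : integral n%:~R.
Proof. exact: (@integral_id _ _ intr). Qed.

Let integralM x y : integral x -> integral y -> integral (x * y).
Proof. exact: (@integral_mul _ _ intr). Qed.

Let integralD x y : integral x -> integral y -> integral (x + y).
Proof. exact: (@integral_add _ _ intr). Qed.

Let integral_k m n : integral (m%:~R + n%:~R * w).
Proof.
apply: integralD => //; apply: integralM => //.
by rewrite w_def; apply: integralOver_golden.
Qed.

Lemma integral_alpha : integral alpha.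
Proof.
apply: (integralOver_quadratic (b := 0) (c := alpha ^+ 2)).
- exact: (integral_int 0).
- by rewrite alpha_sq; apply: integralM.
- by rewrite mul0r add0r.
Qed.

Lemma golden_mul (m n m' n' : int) :
  (m%:~R + n%:~R * w) * (m'%:~R + n'%:~R * w) =
  (m * m' + n * n')%:~R + (m * n' + n * m' + n * n')%:~R * w.
Proof.
rewrite !(rmorphD, rmorphM) /=; move: w_sq; rewrite expr2 => E; ring: E.
Qed.

(* [k] and [l] are the coordinates of the relative norm of [x]. *)
Lemma integral_half_coord x : integral x -> exists m n c0 c1 k l : int,
  [/\ 2 * x = int_comb w alpha m n c0 c1,
    m ^+ 2 + n ^+ 2 - a * (e0 * (c0 ^+ 2 + c1 ^+ 2)
      + e1 * (2 * c0 * c1 + c1 ^+ 2)) = 4 * k &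
    2 * m * n + n ^+ 2 - a * (e1 * (c0 ^+ 2 + c1 ^+ 2)
      + (e0 + e1) * (2 * c0 * c1 + c1 ^+ 2)) = 4 * l].
Proof.
move=> int_x; have [b [c [kb kc ex]]] := K_coord x.
pose x' := b - c * alpha.
have phi_k y j : in_k y -> (phi j y)^*%C = phi j y.
  move=> [u [v ->]]; rewrite rmorphD rmorphM phi_w !phi_iota.
  by rewrite -!(fmorph_rat (real_complex R)) -rmorphM -rmorphD conjc_real.
(* Since k is real and [alpha] purely imaginary under [phi 0], the relative conjugate x' maps to the
   complex conjugate of the image of x. *)
have int_x' : integral x'.
  apply/(integralOver_morph (phi 0)).
  have -> : phi 0 x' = conjc (phi 0 x).
    rewrite ex /x' rmorphB rmorphD !(rmorphM (phi 0)) /=.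
    rewrite (rmorphD conjc) (rmorphM conjc) /= (phi_k b) // (phi_k c) // phi_alpha /=.
    by rewrite -mulrN; congr (_ + _ * _); apply/eqP; rewrite eq_complex /= oppr0 !eqxx.
  apply/(integralOver_morph (conjc : {rmorphism R[i] -> R[i]})).
  exact/integralOver_morph.
have kN1 : in_k (-1) by exact: (in_k_int (-1)).
have k_alpha2 : in_k (alpha ^+ 2).
  rewrite alpha_sq; apply: in_kM; first exact: in_k_int.
  apply: in_kD; first exact: in_k_int.
  by apply: in_kM; [exact: in_k_int | exact: in_k_golden].
have [m [n e2b]] : exists m n : int, 2 * b = m%:~R + n%:~R * w.
  apply: k_integralP; first exact: in_kM (in_k_int 2) kb.
  have -> : 2 * b = x + x' by rewrite ex /x'; ring.
  exact: integralD.
(* Integrality of x - x' = 2 c alpha does not directly give that of 2c; the extra factor [alpha]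
   yields an integral element of k. *)
have [m' [n' eY]] : exists m n : int, 2 * c * alpha ^+ 2 = m%:~R + n%:~R * w.
  apply: k_integralP; first by apply: in_kM => //; exact: in_kM (in_k_int 2) kc.
  have -> : 2 * c * alpha ^+ 2 = (x - x') * alpha by rewrite ex /x'; ring.
  by apply: integralM integral_alpha; apply: (@integral_sub _ _ intr).
have [k [l eN]] : exists m n : int, b ^+ 2 - c ^+ 2 * alpha ^+ 2
    = m%:~R + n%:~R * w.
  apply: k_integralP.
    rewrite -mulN1r !expr2; apply: in_kD; first exact: in_kM.
    by apply: in_kM => //; apply: in_kM => //; exact: in_kM.
  have -> : b ^+ 2 - c ^+ 2 * alpha ^+ 2 = x * x' by rewrite ex /x'; ring.
  exact: integralM.
pose v0 := m ^+ 2 + n ^+ 2 - 4 * k; pose v1 := 2 * m * n + n ^+ 2 - 4 * l.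
have ev : (2 * c) ^+ 2 * alpha ^+ 2 = v0%:~R + v1%:~R * w.
  transitivity ((2 * b) ^+ 2 - 4 * (b ^+ 2 - c ^+ 2 * alpha ^+ 2)).
    by ring.
  rewrite eN e2b expr2 golden_mul /v0 /v1.
  by rewrite !(rmorphD, rmorphM, rmorphXn, rmorphB, rmorphN) /=; ring.
(* The square of 2 c alpha^2 is alpha^2 times v0 + v1 w, so 2 c alpha^2 is itself divisible by
   alpha^2 and 2c lies in Z[w]. *)
have : (2 * c * alpha ^+ 2) ^+ 2 = ((2 * c) ^+ 2 * alpha ^+ 2) * alpha ^+ 2 by ring.
rewrite eY ev alpha_sq mulrCA golden_mul expr2 golden_mul mulrDr mulrA -!rmorphM.
move=> /golden_coord_inj[E1 E2].
have [||c0 [c1 [em' en']]] :=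
    @golden_dvd_of_sqr a e0 e1 m' n' v0 v1 a_squarefree a_coprime5 e_norm.
- by move: E1; rewrite -!expr2 => ->; ring.
- by transitivity (m' * n' + n' * m' + n' * n'); [ring | rewrite E2; ring].
have e2c : 2 * c = c0%:~R + c1%:~R * w.
  have a2 : alpha ^+ 2 != 0 by rewrite sqrf_eq0.
  apply: (mulIf a2); rewrite eY alpha_sq mulrCA golden_mul em' en'.
  by rewrite !(rmorphD, rmorphM) /=; ring.
have : (2 * c) * (2 * c) * alpha ^+ 2 = v0%:~R + v1%:~R * w by rewrite -ev; ring.
rewrite e2c alpha_sq golden_mul mulrCA golden_mul mulrDr mulrA -!rmorphM.
move=> /golden_coord_inj[F1 F2].
exists m, n, c0, c1, k, l; split.
- by rewrite /int_comb -e2b -e2c ex; ring.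
- move: F1; rewrite /v0 => F1.
  transitivity (m ^+ 2 + n ^+ 2 - (m ^+ 2 + n ^+ 2 - 4 * k)); last by ring.
  by rewrite -F1; ring.
- move: F2; rewrite /v1 => F2.
  transitivity (2 * m * n + n ^+ 2 - (2 * m * n + n ^+ 2 - 4 * l)); last by ring.
  by rewrite -F2; ring.
Qed.

End RingOfIntegers.

(** * Embeddings *)

Lemma eq_rmorph_adjoin (L : fieldType) (K : fieldExtType rat) (alpha : K)
    (f g : {rmorphism K -> L}) :
  <<1; alpha>>%VS = fullv -> f alpha = g alpha -> f =1 g.
Proof.
move=> K_gen fg x.
have /Fadjoin1_polyP[p ->] : x \in <<1; alpha>>%VS by rewrite K_gen memvf.
rewrite -!horner_map /= fg -!map_poly_comp; congr _.[_].
apply: eq_map_poly => u /=.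
by rewrite alg_num_field !fmorph_rat.
Qed.

Lemma sqr_complex_pos (R : realType) (z : R[i]) (r : R) :
  0 < r -> z ^+ 2 = r%:C -> exists2 x, z = x%:C & x ^+ 2 = r.
Proof.
case: z => x y r_gt0 /eqP; rewrite expr2 eq_complex /= => /andP[/eqP re /eqP im].
have y0 : y = 0.
  apply/eqP; have /eqP : x * y = 0 by lra.
  rewrite mulf_eq0 => /orP[/eqP x0|//]; move: re; rewrite x0; nra.
by exists x; [rewrite y0 | rewrite -re y0; ring].
Qed.

Lemma sqr_complex_neg (R : realType) (z : R[i]) (r : R) :
  0 < r -> z ^+ 2 = (- r)%:C -> exists2 y, z = 0 +i* y & y ^+ 2 = r.
Proof.
case: z => x y r_gt0 /eqP; rewrite expr2 eq_complex /= => /andP[/eqP re /eqP im].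
have x0 : x = 0.
  apply/eqP; have /eqP : x * y = 0 by lra.
  rewrite mulf_eq0 => /orP[//|/eqP y0]; move: re; rewrite y0; nra.
exists y; first by rewrite x0.
by apply: oppr_inj; rewrite -re x0; ring.
Qed.

Section Embeddings.
Variables (R : realType) (K : fieldExtType rat).
Variables (phi : 'I_2 -> {rmorphism K -> R[i]}).
Variables (sqrt5 alpha : K) (A B N : int).

Hypothesis A_neg : A < 0.
Hypothesis B_ge0 : 0 <= B.
Hypothesis B_le2 : B <= 2.
Hypothesis N_gt0 : 0 < N.
Hypothesis sqrt5_sq : sqrt5 ^+ 2 = 5.
Hypothesis alpha_sq : alpha ^+ 2 = A%:~R * (5 + B%:~R * sqrt5).
Hypothesis K_gen : <<1; alpha>>%VS = fullv.
Hypothesis phi_distinct : ~ (phi 0 =1 phi 1).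
Hypothesis phi_pos : forall j, 0 < complex.Im (phi j (alpha / N%:~R)).

(** Were the two embeddings equal on sqrt 5, the images of [alpha] would be imaginary with equal
    squares and positive imaginary parts, hence equal; as [alpha] generates K, the embeddings would
    coincide. *)
Lemma CM_type_values : exists (r5 : R) (t : 'I_2 -> R),
  let sg j := if j == 0 then r5 else - r5 in
  [/\ r5 ^+ 2 = 5, forall j, phi j sqrt5 = (sg j)%:C,
    forall j, phi j alpha = 0 +i* t j, forall j, 0 < t j &
    forall j, t j ^+ 2 = - A%:~R * (5 + B%:~R * sg j)].
Proof.
have phi_sqrt5 j : exists2 x, phi j sqrt5 = x%:C & x ^+ 2 = 5 :> R.
  apply: sqr_complex_pos; first by rewrite ltr0n.
  by rewrite -rmorphXn sqrt5_sq !rmorph_nat.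
have [r0 phi0 r0_sq] := phi_sqrt5 0; have [r1 phi1 r1_sq] := phi_sqrt5 1.
have A_neg' : (A%:~R : R) < 0 by rewrite ltrz0.
have B_ge0' : 0 <= (B%:~R : R) by rewrite ler0z.
have B_le2' : (B%:~R : R) <= 2 by rewrite (ler_int _ B 2).
have phi_alpha j r : phi j sqrt5 = r%:C -> r ^+ 2 = 5 ->
    exists y, [/\ phi j alpha = 0 +i* y, 0 < y & y ^+ 2 = - A%:~R * (5 + B%:~R * r)].
  move=> phi_s r_sq.
  (* Positivity of 5 + B r follows from |B r| <= 2 sqrt 5 < 5. *)
  have pos : 0 < - A%:~R * (5 + B%:~R * r).
    by rewrite mulr_gt0 ?oppr_gt0 //; nra.
  have [|y ey y_sq] := @sqr_complex_neg R (phi j alpha) _ pos.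
    rewrite -rmorphXn alpha_sq rmorphM rmorphD rmorphM phi_s !rmorph_int rmorph_nat.
    rewrite mulNr opprK rmorphM rmorphD rmorphM /= !rmorph_int.
    by rewrite (rmorph_nat (real_complex R)).
  exists y; split=> //; have := phi_pos j.
  rewrite fmorph_div ey rmorph_int -(rmorph_int (real_complex R)) -fmorphV /=.
  rewrite mul0r add0r pmulr_lgt0 // invr_gt0 ltr0z //.
have [t0 [phi0a t0_gt0 t0_sq]] := phi_alpha 0 _ phi0 r0_sq.
have [t1 [phi1a t1_gt0 t1_sq]] := phi_alpha 1 _ phi1 r1_sq.
have r1E : r1 = - r0.
  have /eqP := etrans r1_sq (esym r0_sq); rewrite eqf_sqr => /orP[/eqP r10|/eqP //].
  case: phi_distinct; apply: (eq_rmorph_adjoin K_gen).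
  rewrite phi0a phi1a; congr (0 +i* _); apply/eqP.
  by rewrite -(eqrXn2 (n := 2)) ?ltW // t0_sq t1_sq r10.
exists r0, (fun j : 'I_2 => if j == 0 then t0 else t1).
have ord2 (P : 'I_2 -> Prop) : P 0 -> P 1 -> forall j, P j.
  by move=> P0 P1; case=> -[|[|//]] lti; [move: P0 | move: P1]; congr P; apply/val_inj.
by split=> //; apply: ord2; rewrite //= -r1E.
Qed.

End Embeddings.

(** * Assembly of cases (ii), (iii) and (v) *)

Lemma pure_imaginary_div (R : realType) (y : R) (N : int) :
  (0 +i* y) / N%:~R = 0 +i* (y / N%:~R).
Proof.
rewrite -(rmorph_int (real_complex R)) -fmorphV.
by apply/eqP; rewrite eq_complex /=; apply/andP; split; apply/eqP; ring.
Qed.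

Theorem theorem3p9 (R : realType) (A B C : int)
  (A_odd : ~~ (2 %| A)%Z) (A_squarefree : squarefree A) (A_neg : A < 0)
  (A_coprime5 : gcdz A 5 = 1) (B_pos : 0 < B) (C_pos : 0 < C)
  (BC_eq5 : B ^+ 2 + C ^+ 2 = 5)
  (K : fieldExtType rat) (sqrt5 alpha : K)
  (sqrt5_sq : sqrt5 ^+ 2 = 5)
  (alpha_sq : alpha ^+ 2 = A%:~R * (5 + B%:~R * sqrt5))
  (K_gen : <<1; alpha>>%VS = fullv)
  (phi : 'I_2 -> {rmorphism K -> R[i]})
  (phi_distinct : ~ (phi 0 =1 phi 1))
  (phi_pos : forall j, 0 < complex.Im (phi j (zeta A B C alpha))) :
  principal_polarization (Lambda phi (ring_of_integers (K:=K)))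
    (Eform phi (zeta A B C alpha)).
Proof.
have BC : (B = 1 /\ C = 2) \/ (B = 2 /\ C = 1) by nia.
have two_neq0 : 2%:R != 0 :> K.
  by rewrite -(fmorph_eq0 (phi 0)) rmorph_nat pnatr_eq0.
have int_w := integralOver_golden two_neq0 sqrt5_sq.
have A_neq0 : (A%:~R : R) != 0 by rewrite intr_eq0 lt_eqF.
have intrNA (k : nat) : (- k%:R * A)%:~R = - k%:R * A%:~R :> R.
  by rewrite intrM rmorphN rmorph_nat.
have sqrt5E : sqrt5 = 2 * golden sqrt5 - 1 by rewrite /golden; field.
have half (m : int) : (2 %| m)%Z -> exists m', m = 2 * m'.
  by case/dvdzP=> m' ->; exists m'; rewrite mulrC.
have alpha_neq0 : alpha != 0.
  apply/eqP => a0; have := phi_pos 0.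
  by rewrite a0 /zeta !mul0r !if_same rmorph0 ltxx.
case: BC => -[? ?]; subst B C.
- rewrite /zeta [case_ii 1]/= in phi_pos *.
  have N_gt0 : 0 < - 20 * A by nia.
  have [r5 [t [r5_sq phi_s phi_a t_gt0 t_sq]]] :=
    @CM_type_values R K phi sqrt5 alpha A 1 (- 20 * A)
      A_neg isT isT N_gt0 sqrt5_sq alpha_sq K_gen phi_distinct phi_pos.
  have aE : alpha ^+ 2 = (2 * A)%:~R * (2%:~R + 1%:~R * golden sqrt5).
    by rewrite alpha_sq {1}sqrt5E rmorphM /=; ring.
  have int_a : integralOver (intr : int -> K) alpha.
    exact: (integral_alpha phi erefl sqrt5_sq aE).
  have sqf2 := squarefree_double A_squarefree A_odd.
  have cop2 : gcdz (2 * A) 5 = 1.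
    by apply/eqP; rewrite -[_ == _]/(coprimez _ _) coprimezMl /coprimez A_coprime5.
  (* Here 2 y t = (5 + r) / 10 is the conjugate of w / sqrt 5, whence F_1 = 1 and F_2 = 1. *)
  apply: (@polarization_of_basis R K phi sqrt5 alpha _ r5 0 t
    (fun j => t j / (- 20 * A)%:~R) 1 1) => //.
  + by move=> j; rewrite fmorph_div phi_a rmorph_int pure_imaginary_div.
  + by move=> j; rewrite gt_eqF.
  + by move=> j; rewrite divr_gt0 // ltr0z.
  + move=> j; transitivity (2 * (t j ^+ 2) / (- 20 * A)%:~R); first by ring.
    by rewrite t_sq intrNA; set q := (if _ then _ else _); field.
  apply/seteqP; split=> [x int_x | _ [m [n [k [l ->]]]]]; last first.
    exact: integralOver_int_comb.
  have [m [n [c0 [c1 [k [l [e2x e1 e2]]]]]]] :=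
    @integral_half_coord R K (in_alg K) phi sqrt5 (golden sqrt5) alpha r5 t
      (2 * A) 2 1 (fun=> erefl) erefl sqrt5_sq r5_sq phi_s phi_a alpha_neq0 aE
      erefl sqf2 cop2 K_gen x int_x.
  have [] := @even_case_ii A m n c0 c1 k l A_odd.
  - by rewrite -e1; ring.
  - by rewrite -e2; ring.
  move=> /half[m' ?] /half[n' ?] /half[c0' ?] /half[c1' ?]; subst.
  exists m', n', c0', c1'; apply: (mulfI two_neq0).
  by rewrite e2x /int_comb !rmorphM /=; ring.
have aE : alpha ^+ 2 = A%:~R * (3%:~R + 4%:~R * golden sqrt5).
  by rewrite alpha_sq {1}sqrt5E /=; ring.
have int_a : integralOver (intr : int -> K) alpha.
  exact: (integral_alpha phi erefl sqrt5_sq aE).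
(* With B = 2 and C = 1, the class 1 modulo 4 is case (iii) and the class 3 is case (v). *)
have Amod : (A == 1 %[mod 4])%Z \/ (A == 3 %[mod 4])%Z by lia.
case: Amod => Amod.
- have zE : zeta A 2 1 alpha = alpha / (- 10 * A)%:~R.
    rewrite /zeta (_ : case_ii 2 = false) // (_ : case_iii A 2 = true) //.
    by rewrite /case_iii; lia.
  rewrite zE in phi_pos *.
  have N_gt0 : 0 < - 10 * A by nia.
  have [r5 [t [r5_sq phi_s phi_a t_gt0 t_sq]]] :=
    @CM_type_values R K phi sqrt5 alpha A 2 (- 10 * A)
      A_neg isT isT N_gt0 sqrt5_sq alpha_sq K_gen phi_distinct phi_pos.
  (* Here 2 y t = (5 + 2 r) / 5 is the conjugate of w^3 / sqrt 5, whence F_3 = 2 and F_4 = 3. *)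
  apply: (@polarization_of_basis R K phi sqrt5 alpha _ r5 0 t
    (fun j => t j / (- 10 * A)%:~R) 2 3) => //.
  + by move=> j; rewrite fmorph_div phi_a rmorph_int pure_imaginary_div.
  + by move=> j; rewrite gt_eqF.
  + by move=> j; rewrite divr_gt0 // ltr0z.
  + move=> j; transitivity (2 * (t j ^+ 2) / (- 10 * A)%:~R); first by ring.
    by rewrite t_sq intrNA; set q := (if _ then _ else _); field.
  apply/seteqP; split=> [x int_x | _ [m [n [k [l ->]]]]]; last first.
    exact: integralOver_int_comb.
  have [m [n [c0 [c1 [k [l [e2x e1 e2]]]]]]] :=
    @integral_half_coord R K (in_alg K) phi sqrt5 (golden sqrt5) alpha r5 t
      A 3 4 (fun=> erefl) erefl sqrt5_sq r5_sq phi_s phi_a alpha_neq0 aE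
      erefl A_squarefree A_coprime5 K_gen x int_x.
  have [] := @even_case_iii A m n c0 c1 k l Amod.
  - by rewrite -e1; ring.
  - by rewrite -e2; ring.
  move=> /half[m' ?] /half[n' ?] /half[c0' ?] /half[c1' ?]; subst.
  exists m', n', c0', c1'; apply: (mulfI two_neq0).
  by rewrite e2x /int_comb !rmorphM /=; ring.
have zE : zeta A 2 1 alpha = alpha / (- 5 * A)%:~R.
  rewrite /zeta (_ : case_ii 2 = false) // (_ : case_iii A 2 = false); last first.
    by rewrite /case_iii; lia.
  by rewrite (_ : case_v A 2 1 = true) ?orbT // /case_v; lia.
rewrite zE in phi_pos *.
have N_gt0 : 0 < - 5 * A by nia.
have [r5 [t [r5_sq phi_s phi_a t_gt0 t_sq]]] :=
  @CM_type_values R K phi sqrt5 alpha A 2 (- 5 * A)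
    A_neg isT isT N_gt0 sqrt5_sq alpha_sq K_gen phi_distinct phi_pos.
pose theta := (1 + alpha) / 2.
(* The imaginary part of [theta] is half that of [alpha], but [zeta] is twice that of case (iii), so
   the traces 2 and 3 are unchanged. *)
apply: (@polarization_of_basis R K phi sqrt5 theta _ r5 (1 / 2)
  (fun j => t j / 2) (fun j => t j / (- 5 * A)%:~R) 2 3) => //.
+ move=> j; rewrite fmorph_div rmorphD rmorph1 phi_a rmorph_nat.
  rewrite -(rmorph1 (real_complex R)) -(rmorph_nat (real_complex R)) -fmorphV.
  by apply/eqP; rewrite eq_complex /=; apply/andP; split; apply/eqP; ring.
+ by move=> j; rewrite fmorph_div phi_a rmorph_int pure_imaginary_div.
+ by move=> j; rewrite gt_eqF // divr_gt0.
+ by move=> j; rewrite divr_gt0 // ltr0z.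
+ move=> j; transitivity ((t j ^+ 2) / (- 5 * A)%:~R); first by field.
  by rewrite t_sq intrNA; set q := (if _ then _ else _); field.
apply/seteqP; split=> [x int_x | _ [m [n [k [l ->]]]]]; last first.
  apply: integralOver_int_comb => //.
  have [A' eA] : exists A', A = 4 * A' + 3 by exists (A %/ 4)%Z; lia.
  (* theta^2 = theta + (alpha^2 - 1) / 4, and for A = 4 A' + 3 the last term is 3 A' + 2 + A w. *)
  apply: (integralOver_quadratic (b := 1)
    (c := int_comb (golden sqrt5) 0 (3 * A' + 2) A 0 0)).
  - exact: (@integral1 _ _ intr).
  - by apply: integralOver_int_comb => //; apply: (@integral0 _ _ intr).
  apply: (mulfI (mulf_neq0 two_neq0 two_neq0)).
  transitivity (1 + 2 * alpha + alpha ^+ 2); first by rewrite /theta; field.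
  rewrite aE /theta /int_comb eA !rmorphD !rmorphM /=; field.
  done.
have [m [n [c0 [c1 [k [l [e2x e1 e2]]]]]]] :=
  @integral_half_coord R K (in_alg K) phi sqrt5 (golden sqrt5) alpha r5 t
    A 3 4 (fun=> erefl) erefl sqrt5_sq r5_sq phi_s phi_a alpha_neq0 aE
    erefl A_squarefree A_coprime5 K_gen x int_x.
have [] := @even_case_v A m n c0 c1 k l Amod.
- by rewrite -e1; ring.
- by rewrite -e2; ring.
move=> /half[m' em] /half[n' en].
(* Substituting alpha = 2 theta - 1 into 2x shifts m and n by - c0 and - c1, so x has coordinates (m
   - c0) / 2, (n - c1) / 2, c0, c1. *)
exists m', n', c0, c1; apply: (mulfI two_neq0); rewrite e2x.
have -> : m = 2 * m' + c0 by rewrite -em; ring.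
have -> : n = 2 * n' + c1 by rewrite -en; ring.
rewrite /int_comb /theta !rmorphD !rmorphM /=.
by field.
Qed.
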